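(* Let $u=24+5\sqrt{23}$ and, for every integer $k\ge 0$, let $T_k,S_k\in\mathbb Z$ be defined by $$T_k+S_k\sqrt{23}=(1+\sqrt{23})\,u^k .$$ Put $$\mathcal A=\{k\in\mathbb Z_{\ge 0}: k\equiv 15 \ \text{or}\ 440 \pmod{575}\}.$$ For every $k\in\mathcal A$ define $$c_k=\frac{S_k^2-1}{5},\qquad x_k=\frac{c_k-120}{575}=\frac{S_k^2-601}{2875},\qquad y_k=c_kx_k+1 .$$ Then the following statements hold for every $k\in\mathcal A$. 1. $c_k,x_k,y_k$ are positive integers and $\{5,115,c_k\}$ is a Diophantine triple. 2. $(x_k,y_k)$ and $(x_k,-y_k)$ are integral points on the elliptic curve $$E_k:\qquad y^2=(5x+1)(115x+1)(c_kx+1).$$ 3. Each of $5x_k+1$, $115x_k+1$, and $c_kx_k+1$ is a nonsquare in $\mathbb Z$. Moreover, for distinct $k\in\mathcal A$ the triples $\{5,115,c_k\}$ are pairwise distinct and the corresponding counterexamples (the triple $\{5,115,c_k\}$ together with the points $(x_k,\pm y_k)$ on $E_k$) are pairwise distinct, and the least value of $c_k$ over $k\in\mathcal A$ is attained at $k=15$.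
   Context: A set $\{a,b,c\}$ of three distinct positive integers is called a Diophantine triple if $ab+1$, $ac+1$ and $bc+1$ are all perfect squares. An integral point on a curve is a point both of whose coordinates are integers. The integers $T_k,S_k$ are well defined because $1,\sqrt{23}$ is a $\mathbb Z$-basis of $\mathbb Z[\sqrt{23}]$. A ''counterexample'' here means a Diophantine triple $\{a,b,c\}$ together with an integral point $(x,y)$ with $x\neq -1$ on $y^2=(ax+1)(bx+1)(cx+1)$ such that $ax+1$, $bx+1$, $cx+1$ are not all perfect squares. *)

(* Defs.v *)
From Stdlib Require Import Reals ZArith Znumtheory Ensembles Lra Lia Zwf.
Open Scope Z_scope.

Definition perfect_square (n : Z) : Prop := exists m : Z, n = m * m.

(* The predicate is invariant under permutations of [a], [b], [c], so it is a
   property of the set {a, b, c}. *)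
Definition Diophantine_triple (a b c : Z) : Prop :=
  (0 < a /\ 0 < b /\ 0 < c) /\ (a <> b /\ a <> c /\ b <> c) /\
  perfect_square (a * b + 1) /\ perfect_square (a * c + 1) /\
  perfect_square (b * c + 1).

Definition integral_point (a b c : Z) (P : Z * Z) : Prop :=
  let (x, y) := P in y ^ 2 = (a * x + 1) * (b * x + 1) * (c * x + 1).

Definition counterexample (a b c : Z) (P : Z * Z) : Prop :=
  Diophantine_triple a b c /\ integral_point a b c P /\ fst P <> -1 /\
  ~ (perfect_square (a * fst P + 1) /\ perfect_square (b * fst P + 1) /\
     perfect_square (c * fst P + 1)).

Definition same_triple (a b c a' b' c' : Z) : Prop :=
  Same_set Z (Triple Z a b c) (Triple Z a' b' c').

Definition u : R := (24 + 5 * sqrt 23)%R.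

Definition TS_spec (T S : nat -> Z) : Prop :=
  forall k : nat,
    (IZR (T k) + IZR (S k) * sqrt 23 = (1 + sqrt 23) * u ^ k)%R.

Definition in_A (k : nat) : Prop :=
  Z.of_nat k mod 575 = 15 \/ Z.of_nat k mod 575 = 440.

(* Exact real quotients: integrality is not built in, as it would be with [Z.div]. *)
Definition cR (S : nat -> Z) (k : nat) : R := ((IZR (S k) ^ 2 - 1) / 5)%R.
Definition xR (S : nat -> Z) (k : nat) : R := ((cR S k - 120) / 575)%R.
Definition yR (S : nat -> Z) (k : nat) : R := (cR S k * xR S k + 1)%R.

(* [TS_spec] determines [T] and [S]: existence and uniqueness. *)
Lemma TS_spec_exists : exists T S : nat -> Z, TS_spec T S.
Proof.
  pose (ts := fix ts k := match k with
    | O => (1, 1)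
    | S k' => let (t, s) := ts k' in (24 * t + 115 * s, 5 * t + 24 * s)
    end).
  exists (fun k => fst (ts k)), (fun k => snd (ts k)).
  intro k; induction k as [|k IH].
  - simpl; ring.
  - change (u ^ S k)%R with (u * u ^ k)%R.
    replace ((1 + sqrt 23) * (u * u ^ k))%R
      with (u * ((1 + sqrt 23) * u ^ k))%R by ring.
    change (ts (S k)) with
      (let (t, s) := ts k in (24 * t + 115 * s, 5 * t + 24 * s)).
    rewrite <- IH; destruct (ts k) as [t s]; cbn [fst snd].
    rewrite !plus_IZR, !mult_IZR; unfold u.
    assert (H : (sqrt 23 * sqrt 23 = 23)%R) by (apply sqrt_sqrt; lra).
    replace ((24 + 5 * sqrt 23) * (IZR t + IZR s * sqrt 23))%R
      with (24 * IZR t + 24 * IZR s * sqrt 23 + 5 * IZR t * sqrt 23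
            + 5 * IZR s * (sqrt 23 * sqrt 23))%R by ring.
    rewrite H; ring.
Qed.

Lemma square_23 (x y : Z) : x * x = 23 * (y * y) -> y = 0.
Proof.
  revert x; induction y as [y IH] using
    (well_founded_induction (well_founded_ltof Z Z.abs_nat)); intros x H.
  destruct (Z.eq_dec y 0) as [|Hy]; [assumption|exfalso].
  assert (D : forall z, (z * z) mod 23 = 0 -> exists w, z = 23 * w).
  { intros z Hz; rewrite Zmult_mod in Hz.
    exists (z / 23); pose proof (Z.div_mod z 23 ltac:(lia)) as E.
    pose proof (Z.mod_pos_bound z 23 ltac:(lia)) as B.
    set (r := z mod 23) in *; clearbody r.
    assert (C : r = 0 \/ r = 1 \/ r = 2 \/ r = 3 \/ r = 4 \/ r = 5 \/ r = 6 \/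
      r = 7 \/ r = 8 \/ r = 9 \/ r = 10 \/ r = 11 \/ r = 12 \/ r = 13 \/
      r = 14 \/ r = 15 \/ r = 16 \/ r = 17 \/ r = 18 \/ r = 19 \/ r = 20 \/
      r = 21 \/ r = 22) by lia.
    repeat (destruct C as [C|C]; [subst r; cbv in Hz; try discriminate; lia|]).
    subst r; cbv in Hz; discriminate. }
  destruct (D x) as [a Ha]; [rewrite H, Z.mul_comm; apply Z_mod_mult|subst x].
  assert (H2 : y * y = 23 * (a * a)) by lia.
  destruct (D y) as [b Hb]; [rewrite H2, Z.mul_comm; apply Z_mod_mult|subst y].
  assert (H3 : a * a = 23 * (b * b)) by lia.
  assert (b = 0) by (apply (IH b) with a; [unfold ltof; lia|exact H3]); lia.
Qed.

Lemma TS_spec_unique (T S T' S' : nat -> Z) :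
  TS_spec T S -> TS_spec T' S' -> forall k, T k = T' k /\ S k = S' k.
Proof.
  intros H H' k; specialize (H k); specialize (H' k); rewrite <- H' in H.
  assert (Q : (sqrt 23 * sqrt 23 = 23)%R) by (apply sqrt_sqrt; lra).
  assert (E : (IZR (T k - T' k) = IZR (S' k - S k) * sqrt 23)%R)
    by (rewrite !minus_IZR; lra).
  assert (F : (T k - T' k) * (T k - T' k)
              = 23 * ((S' k - S k) * (S' k - S k))).
  { apply eq_IZR; rewrite (mult_IZR (T k - T' k)), E, !mult_IZR.
    replace (IZR (S' k - S k) * sqrt 23 * (IZR (S' k - S k) * sqrt 23))%R
      with (sqrt 23 * sqrt 23 * (IZR (S' k - S k) * IZR (S' k - S k)))%R by ring.
    rewrite Q; reflexivity. }
  pose proof (square_23 _ _ F) as G; rewrite G in F; split; nia.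
Qed.

(* Main.v *)
Require Import Defs.
From Stdlib Require Import Reals ZArith Ensembles Lra Lia.
Open Scope Z_scope.

(** The norm equation [T^2 - 23 S^2 = -22] says that [5 c + 1 = S^2] and
    [115 c + 1 = T^2], which together with [5 * 115 + 1 = 24^2] makes
    {5, 115, c} a Diophantine triple.  The choice [575 x = c - 120] turns
    [(5 x + 1) (115 x + 1) = 575 x^2 + 120 x + 1] into [c x + 1], so the cubic
    is the square of [y = c x + 1].

    Integrality of [x] means [S^2 = 601] modulo [2875 = 23 * 125].  Modulo 23
    the unit [u] is [1 + 5 sqrt 23] with [sqrt 23] nilpotent, and modulo 5 it is
    [-1]; expanding [u^k] by the binomial theorem gives [S_k = 1 + 5 k] modulo
    23 ([S_mod_23]) and [S_k = (-1)^k (1 - 5 k - 25 k^2)] modulo 125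
    ([TS_mod_125]).  The condition on [S] thus depends on [k] modulo 23 and 25
    only, and the two residue classes modulo 575 satisfy it
    ([quotient_2875]).

    For the nonsquares, [25 (115 x + 1) = S^2 - 24^2] and
    [115^2 (5 x + 1) = T^2 - 24^2], whereas a large square minus 576 is not a
    square ([square_minus_576_nonsquare]).  If [c x + 1], the product of
    [p = 5 x + 1] and [q = 115 x + 1], were a square, then [p] and [q] would
    share their squarefree part ([square_product_common_factor]):
    [p = h r^2] and [q = h s^2], where [h] divides [23 p - q = 22].  As [S] is
    odd, [x] is divisible by 8, so [p = 1] modulo 8.  Then [r] is odd,
    [h = h r^2 = p = 1] modulo 8, and the only such divisor of 22 is [h = 1],
    which makes [q] a square ([factors_nonsquare]).

    Distinctness and minimality follow from the strict growth of [S]. *)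

(** * The recurrence and its invariants *)

(** The sequences are given through real numbers; uniqueness of the coordinates
    in the basis 1, [sqrt 23], applied to the pair generated by the recurrence
    step, transfers multiplication by [u] to the integers. *)
Lemma TS_recurrence (T S : nat -> Z) : TS_spec T S ->
  (T 0%nat = 1 /\ S 0%nat = 1) /\
  forall k, T (Datatypes.S k) = 24 * T k + 115 * S k /\
            S (Datatypes.S k) = 5 * T k + 24 * S k.
Proof.
  intro H.
  pose (T' k := match k with O => 1 | Datatypes.S k => 24 * T k + 115 * S k end).
  pose (S' k := match k with O => 1 | Datatypes.S k => 5 * T k + 24 * S k end).
  assert (H' : TS_spec T' S').
  { intros [|k]; cbn [T' S']; [simpl; ring|].
    replace ((1 + sqrt 23) * u ^ Datatypes.S k)%R
      with (u * ((1 + sqrt 23) * u ^ k))%R by (simpl; ring).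
    rewrite <- (H k), !plus_IZR, !mult_IZR; unfold u.
    assert (Q : (sqrt 23 * sqrt 23 = 23)%R) by (apply sqrt_sqrt; lra).
    transitivity (24 * IZR (T k) + 24 * IZR (S k) * sqrt 23
                  + 5 * IZR (T k) * sqrt 23
                  + 5 * IZR (S k) * (sqrt 23 * sqrt 23))%R;
      [rewrite Q|]; ring. }
  pose proof (TS_spec_unique _ _ _ _ H H') as E.
  split; [exact (E 0%nat) | intro k; exact (E (Datatypes.S k))].
Qed.

Section Sequences.

Variables T S : nat -> Z.
Hypothesis spec : TS_spec T S.

Lemma TS_norm k : T k * T k = 23 * (S k * S k) - 22.
Proof.
  destruct (TS_recurrence T S spec) as [[T0 S0] step].
  induction k as [|k IH]; [rewrite T0, S0; reflexivity|].
  destruct (step k) as [-> ->]; lia.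
Qed.

Lemma TS_positive k : 0 < T k /\ 0 < S k.
Proof.
  destruct (TS_recurrence T S spec) as [[T0 S0] step].
  induction k as [|k IH]; [lia|]; destruct (step k); lia.
Qed.

Lemma S_increasing k l : (k < l)%nat -> S k < S l.
Proof.
  destruct (TS_recurrence T S spec) as [_ step].
  induction 1 as [|l _ IH];
    [destruct (step k), (TS_positive k) | destruct (step l), (TS_positive l)];
    lia.
Qed.

Lemma TS_large k : (2 <= k)%nat -> 289 <= S k <= T k.
Proof.
  intro Hk; destruct (TS_recurrence T S spec) as [[T0 S0] step].
  destruct (step 0%nat), (step 1%nat).
  assert (S 2%nat <= S k).
  { destruct (Nat.eq_dec k 2) as [->|]; [lia|].
    apply Z.lt_le_incl, S_increasing; lia. }
  pose proof (TS_norm k); pose proof (TS_positive k); nia.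
Qed.

(** An even [S] would give [T^2 = 2] modulo 4. *)
Lemma S_odd k : exists r, S k = 2 * r + 1.
Proof.
  destruct (Z.Even_or_Odd (S k)) as [[r E]|O]; [exfalso|exact O].
  pose proof (TS_norm k) as N; rewrite E in N.
  destruct (Z.Even_or_Odd (T k)) as [[t F]|[t F]]; rewrite F in N; lia.
Qed.

(** * Integrality of the abscissa *)

(** Modulo 23 the square of [sqrt 23] vanishes and [24 = 1], so
    [(1 + sqrt 23) (1 + 5 sqrt 23)^k = 1 + (1 + 5 k) sqrt 23]. *)
Lemma S_mod_23 k : exists b, S k = 1 + 5 * Z.of_nat k + 23 * b.
Proof.
  enough (exists a b, T k = 1 + 23 * a /\ S k = 1 + 5 * Z.of_nat k + 23 * b)
    as (a & b & _ & E) by (exists b; exact E).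
  destruct (TS_recurrence T S spec) as [[T0 S0] step].
  induction k as [|k (a & b & Ha & Hb)]; [exists 0, 0; lia|].
  destruct (step k) as [-> ->]; rewrite Ha, Hb, Nat2Z.inj_succ.
  exists (1 + 24 * a + 5 * (1 + 5 * Z.of_nat k) + 115 * b),
         (1 + 5 * a + 5 * Z.of_nat k + 24 * b); lia.
Qed.

(** Here [-u = 1 - 5 w] with [w = 5 + sqrt 23] and [w^2 = -2] modulo 5, so that
    [(-u)^k = 1 - 5 k w - 25 k (k - 1)] modulo 125: the terms of order three and
    more vanish.  The sign [e] is [(-1)^k]. *)
Lemma TS_mod_125 k : exists e a b, (e = 1 \/ e = -1) /\
  T k = e * (1 + 10 * Z.of_nat k - 25 * Z.of_nat k ^ 2) + 125 * a /\
  S k = e * (1 - 5 * Z.of_nat k - 25 * Z.of_nat k ^ 2) + 125 * b.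
Proof.
  destruct (TS_recurrence T S spec) as [[T0 S0] step].
  induction k as [|k (e & a & b & He & Ha & Hb)]; [exists 1, 0, 0; lia|].
  destruct (step k) as [-> ->]; rewrite Ha, Hb, Nat2Z.inj_succ.
  set (n := Z.of_nat k); unfold Z.succ.
  exists (- e), (e * (1 - 3 * n - 28 * n ^ 2) + 24 * a + 115 * b),
         (e * (- n - 6 * n ^ 2) + 5 * a + 24 * b).
  split; [lia|split; ring].
Qed.

(** Both residue classes modulo 575 reduce to 15 modulo 25, where
    [S = (-1)^k (1 - 75) = (-1)^k * -74] and [74^2 = 601] modulo 125; modulo 23
    they reduce to 15 and 3, where [S] is 7 and -7. *)
Lemma quotient_2875 k : in_A k -> exists x, S k * S k = 2875 * x + 601.
Proof.
  intro A.
  assert (M : exists j, Z.of_nat k = 575 * j + 15 \/ Z.of_nat k = 575 * j + 440)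
    by (exists (Z.of_nat k / 575);
        pose proof (Z.div_mod (Z.of_nat k) 575); unfold in_A in A; lia).
  destruct M as [j M].
  assert (D23 : (23 | S k * S k - 601)).
  { destruct (S_mod_23 k) as [b E].
    assert (F : exists d, S k = 23 * d + 7 \/ S k = 23 * d - 7)
      by (destruct M as [M|M]; rewrite M in E;
          [exists (125 * j + 3 + b) | exists (125 * j + 96 + b)]; lia).
    destruct F as [d [F|F]]; rewrite F;
      [exists (23 * d * d + 14 * d - 24) | exists (23 * d * d - 14 * d - 24)];
      ring. }
  assert (D125 : (125 | S k * S k - 601)).
  { destruct (TS_mod_125 k) as (e & _ & b & He & _ & E).
    assert (L : exists i, Z.of_nat k = 25 * i + 15)
      by (destruct M as [M|M]; rewrite M; [exists (23 * j) | exists (23 * j + 17)];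
          ring).
    destruct L as [i L]; rewrite L in E.
    set (d := b - e * (45 + 151 * i + 125 * i ^ 2)).
    assert (F : S k = 125 * d - 74 * e) by (rewrite E; unfold d; ring).
    rewrite F; exists (125 * d * d - 148 * e * d + 39).
    destruct He as [-> | ->]; ring. }
  destruct D23 as [p Hp], D125 as [q Hq].
  (* Bezout: [87 * 23 - 16 * 125 = 1]. *)
  exists (87 * q - 16 * p); lia.
Qed.

End Sequences.

(** * Nonsquares *)

(** Consecutive squares from [288^2] on differ by at least [577]. *)
Lemma square_minus_576_nonsquare n w : 289 <= n -> n * n - 576 = w * w -> False.
Proof. intros Hn E; assert (Z.abs w <= n - 1) by nia; nia. Qed.

(** With [g = gcd a z], [a = g r] and [z = g s], the identity
    [r b = g s^2] and the coprimality of [r] and [s] force [r] to divide [g]. *)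
Lemma square_product_common_factor a b z : 0 < a -> a * b = z * z ->
  exists h r s, a = h * (r * r) /\ b = h * (s * s).
Proof.
  intros Ha E.
  destruct (Z.gcd_divide_l a z) as [r Hr], (Z.gcd_divide_r a z) as [s Hs].
  assert (Hg : 0 < Z.gcd a z)
    by (pose proof (Z.gcd_nonneg a z); destruct (Z.eq_dec (Z.gcd a z) 0); nia).
  assert (C : Z.gcd r s = 1)
    by (pose proof (Z.gcd_mul_mono_r_nonneg r s (Z.gcd a z)) as M;
        rewrite <- Hr, <- Hs in M; nia).
  set (g := Z.gcd a z) in *; clearbody g.
  assert (F : r * b = g * (s * s)).
  { apply (Z.mul_reg_l _ _ g); [lia|]. rewrite Hr, Hs in E; nia. }
  assert (D : (r | g)).
  { apply (Z.gauss r s); [|exact C]; apply (Z.gauss r s); [|exact C].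
    exists b; lia. }
  destruct D as [h ->]; exists h, r, s; split; [lia|].
  apply (Z.mul_reg_l _ _ r); nia.
Qed.

Lemma odd_square_mod_8 n : (exists r, n = 2 * r + 1) -> exists j, n * n = 8 * j + 1.
Proof.
  intros [r ->]; destruct (Z.Even_or_Odd r) as [[i ->]|[i ->]];
    [exists (2 * i * i + i) | exists (2 * i * i + 3 * i + 1)]; ring.
Qed.

Lemma factors_nonsquare s t x : 289 <= s -> 289 <= t ->
  (exists r, s = 2 * r + 1) ->
  t * t = 23 * (s * s) - 22 -> s * s = 2875 * x + 601 ->
  ~ perfect_square (5 * x + 1) /\ ~ perfect_square (115 * x + 1) /\
  ~ perfect_square ((5 * x + 1) * (115 * x + 1)).
Proof.
  intros Hs Ht O N X.
  assert (P : ~ perfect_square (5 * x + 1))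
    by (intros [m E]; apply (square_minus_576_nonsquare t (115 * m)); lia).
  assert (Q : ~ perfect_square (115 * x + 1))
    by (intros [m E]; apply (square_minus_576_nonsquare s (5 * m)); lia).
  split; [exact P|split; [exact Q|]].
  intros [z E].
  assert (0 < x) by nia.
  destruct (square_product_common_factor (5 * x + 1) (115 * x + 1) z)
    as (h & r & q & Hp & Hq); [lia|exact E|].
  destruct (odd_square_mod_8 s O) as [j J].
  assert (D : h * (23 * (r * r) - q * q) = 22) by lia.
  assert (h > 0) by nia.
  (* [2875 = 3] modulo 8, so [2875 x = s^2 - 601] makes [x] a multiple of 8. *)
  assert (Y : exists i, x = 8 * i) by (exists (3 * j - 225 - 1078 * x); lia).
  destruct Y as [i Y].
  assert (R : exists l, r = 2 * l + 1).
  { destruct (Z.Even_or_Odd r) as [[l L]|L]; [|exact L].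
    rewrite L, Y in Hp; lia. }
  destruct (odd_square_mod_8 r R) as [l L].
  rewrite L, Y in Hp.
  assert (H8 : h = 8 * (5 * i - h * l) + 1) by lia.
  assert (h <= 22)
    by (apply Z.divide_pos_le; [lia|exists (23 * (r * r) - q * q); lia]).
  assert (V : h = 1 \/ h = 9 \/ h = 17) by lia.
  destruct V as [-> | [-> | ->]]; [|lia|lia].
  apply Q; exists q; lia.
Qed.

(** * The family of counterexamples *)

Lemma same_triple_third a b c c' :
  c <> a -> c <> b -> same_triple a b c a b c' -> c = c'.
Proof.
  intros Ha Hb [I _].
  assert (M : In Z (Triple Z a b c') c) by (apply I; constructor).
  inversion M; congruence.
Qed.

Theorem theorem3p1 :
  forall T S : nat -> Z, TS_spec T S ->
  (forall k : nat, in_A k -> (xR S k = (IZR (S k) ^ 2 - 601) / 2875)%R) /\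
  exists c x y : nat -> Z,
    (forall k : nat, in_A k ->
      ((IZR (c k) = cR S k /\ IZR (x k) = xR S k /\ IZR (y k) = yR S k) /\
       (0 < c k /\ 0 < x k /\ 0 < y k) /\
       Diophantine_triple 5 115 (c k)) /\
      (integral_point 5 115 (c k) (x k, y k) /\
       integral_point 5 115 (c k) (x k, - y k)) /\
      (~ perfect_square (5 * x k + 1) /\
       ~ perfect_square (115 * x k + 1) /\
       ~ perfect_square (c k * x k + 1)) /\
      (counterexample 5 115 (c k) (x k, y k) /\
       counterexample 5 115 (c k) (x k, - y k))) /\
    (forall k l : nat, in_A k -> in_A l -> k <> l ->
      ~ same_triple 5 115 (c k) 5 115 (c l)) /\
    (forall (k l : nat) (s t : Z), in_A k -> in_A l ->
      (s = 1 \/ s = -1) -> (t = 1 \/ t = -1) -> (k, s) <> (l, t) ->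
      ~ (same_triple 5 115 (c k) 5 115 (c l) /\
         (x k, s * y k) = (x l, t * y l))) /\
    (in_A 15 /\ forall k : nat, in_A k -> c 15%nat <= c k).
Proof.
  intros T S spec.
  set (c k := (S k * S k - 1) / 5); set (x k := (c k - 120) / 575).
  assert (K : forall k, in_A k -> (15 <= k)%nat)
    by (intros k A; unfold in_A in A;
        pose proof (Z.mod_le (Z.of_nat k) 575); lia).
  assert (V : forall k, in_A k ->
    S k * S k = 5 * c k + 1 /\ c k = 575 * x k + 120).
  { intros k A; destruct (quotient_2875 T S spec k A) as [q Q].
    assert (C : c k = 575 * q + 120)
      by (unfold c; symmetry; apply Z.div_unique_exact; lia).
    assert (X : x k = q)
      by (unfold x; symmetry; apply Z.div_unique_exact; lia).
    rewrite X, C; lia. }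
  assert (L : forall k, in_A k -> 289 <= S k <= T k)
    by (intros k A; apply (TS_large T S spec); specialize (K k A); lia).
  assert (Pos : forall k, in_A k -> 120 < c k /\ 0 < x k /\ 0 < c k * x k + 1).
  { intros k A; destruct (V k A), (L k A).
    assert (0 < x k) by nia. nia. }
  assert (Inj : forall k l, in_A k -> in_A l -> c k = c l -> k = l).
  { intros k l A B E; destruct (V k A), (V l B), (L k A), (L l B).
    assert (S k = S l) by nia.
    destruct (Nat.lt_trichotomy k l) as [Hlt|[Heq|Hlt]]; [|exact Heq|];
      apply (S_increasing T S spec) in Hlt; lia. }
  assert (Dist : forall k l, in_A k -> in_A l ->
    same_triple 5 115 (c k) 5 115 (c l) -> k = l).
  { intros k l A B E; destruct (Pos k A).
    apply Inj; [assumption..|].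
    apply same_triple_third in E; [exact E|lia|lia]. }
  split.
  { intros k _; unfold xR, cR; field. }
  exists c, x, (fun k => c k * x k + 1).
  split; [|split; [|split]].
  - intros k A; destruct (V k A) as [Vc Vx], (L k A), (Pos k A) as (Pc & Px & Py).
    pose proof (TS_norm T S spec k) as N.
    assert (RC : IZR (c k) = cR S k).
    { unfold cR; replace (IZR (S k) ^ 2)%R with (IZR (S k * S k))
        by (rewrite mult_IZR; ring).
      rewrite Vc, plus_IZR, mult_IZR; field. }
    assert (RX : IZR (x k) = xR S k)
      by (unfold xR; rewrite <- RC, Vx, plus_IZR, mult_IZR; field).
    assert (D : Diophantine_triple 5 115 (c k)).
    { split; [lia|split; [lia|split; [|split]]];
        [exists 24 | exists (S k) | exists (T k)]; lia. }
    assert (F : c k * x k + 1 = (5 * x k + 1) * (115 * x k + 1))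
      by (rewrite Vx; ring).
    assert (I : integral_point 5 115 (c k) (x k, c k * x k + 1) /\
                integral_point 5 115 (c k) (x k, - (c k * x k + 1)))
      by (unfold integral_point; rewrite <- F; split; ring).
    destruct (factors_nonsquare (S k) (T k) (x k)) as (N1 & N2 & N3);
      [lia|lia|apply (S_odd T S spec)|exact N|lia|].
    rewrite <- F in N3.
    split; [|split; [exact I|split; [tauto|]]].
    + split; [|split; [lia|exact D]].
      split; [exact RC|split; [exact RX|]].
      unfold yR; rewrite <- RX, <- RC, plus_IZR, mult_IZR; reflexivity.
    + unfold counterexample; cbn [fst].
      assert (x k <> -1) by lia; tauto.
  - intros k l A B H E; exact (H (Dist k l A B E)).
  - intros k l s t A B Hs Ht H [E P].
    apply Dist in E; [subst l|assumption..].
    injection P as P; destruct (Pos k A) as (_ & _ & Py).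
    apply H; f_equal; nia.
  - assert (A15 : in_A 15) by (left; reflexivity).
    split; [exact A15|].
    intros k A; destruct (V k A), (V 15%nat A15), (L k A), (L 15%nat A15).
    destruct (Nat.eq_dec k 15) as [->|Hk]; [lia|].
    assert (S 15%nat < S k)
      by (apply (S_increasing T S spec); specialize (K k A); lia).
    nia.
Qed.
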